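(* Let $C=(a_{ij})_{i,j\in I}$ be a symmetrizable Cartan matrix of finite type, $\leq$ a total ordering on $I$, and $\mathsf{U}=\mathsf{U}(C,\leq)$ the quantic monoid. Let $d,e\in Q^+$ and assume that $$\langle\beta,\alpha\rangle\geq0\quad\text{for all }\alpha,\beta\in R^+\text{ such that }\mathbf{a}_d(\alpha)\neq0\neq\mathbf{a}_e(\beta).$$ Then $(d)\cdot(e)=(d+e)$ in $\mathsf{U}$.
   Context: $\mathbf{N}=\{0,1,2,\ldots\}$. Cartan matrix: $I$ is a finite set; $a_{ii}=2$, $a_{ij}\in\{0,-1,-2,\ldots\}$ for $i\neq j$; there are positive integers $d_i$, chosen minimal, such that $(d_ia_{ij})_{i,j}$ is symmetric, and this symmetric matrix is positive definite. $R^+$ is the set of positive roots of the root system of $C$ (simple roots $\alpha_i$, simple reflections $s_i(\alpha_j)=\alpha_j-a_{ij}\alpha_i$), $Q=\bigoplus_i\mathbf{Z}\alpha_i$, $Q^+=\bigoplus_i\mathbf{N}\alpha_i$. Bilinear form on $Q$: $\langle\alpha_i,\alpha_j\rangle=d_ia_{ij}$ if $i<j$, $=d_i$ if $i=j$, $=0$ if $i>j$. The function $\mathbf{a}_d$: every $d\in Q^+$ has a unique decomposition $d=\sum_{\alpha\in R^+}a_\alpha\alpha$ with $a_\alpha\in\mathbf{N}$ such that $\langle\alpha,\beta\rangle\geq0$ whenever $a_\alpha\neq0\neq a_\beta$; one sets $\mathbf{a}_d(\alpha)=a_\alpha$. Quantic monoid: $\mathsf{U}(C,\leq)$ is the monoid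 with generating set $I$ and relations $i^pj^qi^rj^s=i^{p+r}j^{q+s}$ whenever $i<j$ and $(p,q),(r,s)$ are two consecutive entries (in this order) of the list $L_{ij}$: - $L_{ij}=((0,1),(1,0))$ if $a_{ij}=0$; - $L_{ij}=((0,1),(1,1),(1,0))$ if $a_{ij}=-1=a_{ji}$; - $L_{ij}=((0,1),(1,2),(1,1),(1,0))$ if $a_{ij}=-1,a_{ji}=-2$; - $L_{ij}=((0,1),(1,1),(2,1),(1,0))$ if $a_{ij}=-2,a_{ji}=-1$; - $L_{ij}=((0,1),(1,3),(1,2),(1,2),(2,3),(1,1),(1,0))$ if $a_{ij}=-1,a_{ji}=-3$; - $L_{ij}=((0,1),(1,1),(3,2),(2,1),(2,1),(3,1),(1,0))$ if $a_{ij}=-3,a_{ji}=-1$. Elements $(d)$: with $I=\{i_1<\ldots<i_n\}$, an element $d=\sum_i c_i\alpha_i\in Q^+$ defines $(d)=i_1^{c_{i_1}}\cdot\ldots\cdot i_n^{c_{i_n}}\in\mathsf{U}$. *)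

(* Defs.v *)
From HB Require Import structures.
From mathcomp Require Import all_boot all_order all_algebra.
From mathcomp Require Import finmap boolp.

Set Implicit Arguments.
Unset Strict Implicit.
Unset Printing Implicit Defensive.

Import Order.TTheory GRing.Theory Num.Theory.
Local Open Scope ring_scope.

Section Cartan.

Context (disp : Order.disp_t) (I : finOrderType disp).
Implicit Types (C : I -> I -> int) (D : I -> nat).

Definition cartan_matrix C : Prop :=
  (forall i, C i i = 2) /\ (forall i j, i != j -> C i j <= 0).

Definition symmetrizer C D : Prop :=
  (forall i, (0 < D i)%N) /\
  (forall i j, (D i)%:Z * C i j = (D j)%:Z * C j i).

(* The symmetrizers of C are obtained by rescaling one of them on each
   connected component, so there is a pointwise least one. *)
Definition minimal_symmetrizer C D : Prop :=
  symmetrizer C D /\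
  (forall D' : I -> nat, symmetrizer C D' -> forall i, (D i <= D' i)%N).

Definition symmetrized_posdef C D : Prop :=
  forall x : I -> rat, (exists i, x i != 0) ->
    0 < \sum_i \sum_j x i * ((D i)%:Z * C i j)%:~R * x j.

Definition finite_type_datum C D : Prop :=
  [/\ cartan_matrix C, minimal_symmetrizer C D & symmetrized_posdef C D].

Definition root_lattice := {ffun I -> int}.

Definition simple_root (i : I) : root_lattice := [ffun j => (j == i)%:Z].

Definition Qplus : {pred root_lattice} :=
  [pred x : root_lattice | [forall i : I, 0 <= x i]].

Definition simple_reflection C (i : I) (x : root_lattice) : root_lattice :=
  x - simple_root i *~ (\sum_j x j * C i j).

Inductive is_root C : root_lattice -> Prop :=
  | is_root_simple i : is_root C (simple_root i)
  | is_root_reflection i x :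
      is_root C x -> is_root C (simple_reflection C i x).

Definition positive_root C (x : root_lattice) : Prop :=
  is_root C x /\ x \in Qplus.

Definition euler_simple C D (i j : I) : int :=
  if (i < j)%O then (D i)%:Z * C i j else if i == j then (D i)%:Z else 0.

Definition euler_form C D (x y : root_lattice) : int :=
  \sum_i \sum_j x i * y j * euler_simple C D i j.

(* a is the function \mathbf{a}_x, extended by zero outside of R^+ *)
Definition canonical_decomposition C D (x : root_lattice)
    (a : {fsfun root_lattice -> nat with 0%N}) : Prop :=
  [/\ forall u, a u != 0%N -> positive_root C u,
      x = \sum_(u <- finsupp a) u *+ a u &
      forall u v, a u != 0%N -> a v != 0%N -> 0 <= euler_form C D u v].

(* The repeated entries in the two lists of type G2 are intentional: they
   give the relation x * x = (i^2 j^4), resp. (i^4 j^2), for x = i j^2, resp.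
   i^2 j. The final case does not occur in finite type. *)
Definition rank2_list (aij aji : int) : seq (nat * nat) :=
  if aij == 0 then [:: (0, 1); (1, 0)]%N
  else if (aij, aji) == (-1, -1) then [:: (0, 1); (1, 1); (1, 0)]%N
  else if (aij, aji) == (-1, -2) then [:: (0, 1); (1, 2); (1, 1); (1, 0)]%N
  else if (aij, aji) == (-2, -1) then [:: (0, 1); (1, 1); (2, 1); (1, 0)]%N
  else if (aij, aji) == (-1, -3) then
    [:: (0, 1); (1, 3); (1, 2); (1, 2); (2, 3); (1, 1); (1, 0)]%N
  else if (aij, aji) == (-3, -1) then
    [:: (0, 1); (1, 1); (3, 2); (2, 1); (2, 1); (3, 1); (1, 0)]%N
  else [::].

(* The congruence on the free monoid seq I generated by the defining
   relations. *)
Inductive quantic_cong C : seq I -> seq I -> Prop :=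
  | quantic_rel i j p q r s of (i < j)%O
      & infix [:: (p, q); (r, s)] (rank2_list (C i j) (C j i)) :
      quantic_cong C (nseq p i ++ nseq q j ++ nseq r i ++ nseq s j)
                     (nseq (p + r)%N i ++ nseq (q + s)%N j)
  | quantic_refl u : quantic_cong C u u
  | quantic_sym u v : quantic_cong C u v -> quantic_cong C v u
  | quantic_trans u v w :
      quantic_cong C u v -> quantic_cong C v w -> quantic_cong C u w
  | quantic_cat u u' v v' :
      quantic_cong C u u' -> quantic_cong C v v' ->
      quantic_cong C (u ++ v) (u' ++ v').

Definition quantic_congb C : rel (seq I) := fun u v => `[< quantic_cong C u v >].

Lemma quantic_congb_equiv C : equiv_class_of (quantic_congb C).
Proof.
split=> [u|u v|v u w].
- exact/asboolP/quantic_refl.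
- by apply/asboolP/asboolP => h; exact: quantic_sym.
- by move=> /asboolP huv /asboolP hvw; exact/asboolP/(quantic_trans huv).
Qed.

Canonical quantic_congb_equiv_rel C :=
  EquivRelPack (quantic_congb_equiv C).

End Cartan.

Arguments Qplus {disp} I.

Local Open Scope quotient_scope.

Definition quantic_monoid (disp : Order.disp_t) (I : finOrderType disp)
  (C : I -> I -> int) := {eq_quot quantic_congb C}.

Section QuanticMonoid.

Context (disp : Order.disp_t) (I : finOrderType disp) (C : I -> I -> int).

Local Notation U := (quantic_monoid C).

HB.instance Definition _ := Choice.on U.

Definition quantic_class (u : seq I) : U := \pi_({eq_quot quantic_congb C}) u.

Lemma quantic_classP (u v : seq I) :
  quantic_class u = quantic_class v <-> quantic_cong C u v.
Proof.
split=> [/eqmodP/asboolP //|h]; exact/eqmodP/asboolP.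
Qed.

Definition quantic_word (x : U) : seq I := repr (x : {eq_quot quantic_congb C}).

Lemma quantic_wordK : cancel quantic_word quantic_class.
Proof. exact: reprK. Qed.

Definition quantic_one : U := quantic_class [::].
Definition quantic_mul (x y : U) : U :=
  quantic_class (quantic_word x ++ quantic_word y).

Lemma quantic_mulE (u v : seq I) :
  quantic_mul (quantic_class u) (quantic_class v) = quantic_class (u ++ v).
Proof.
by apply/quantic_classP; apply: quantic_cat; apply/quantic_classP;
  rewrite quantic_wordK.
Qed.

Fact quantic_mulA : associative quantic_mul.
Proof.
move=> x y z; rewrite -[x]quantic_wordK -[y]quantic_wordK -[z]quantic_wordK.
by rewrite !quantic_mulE catA.
Qed.

Fact quantic_mul1 : left_id quantic_one quantic_mul.
Proof. by move=> x; rewrite -[x]quantic_wordK quantic_mulE. Qed.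

Fact quantic_mulr1 : right_id quantic_one quantic_mul.
Proof. by move=> x; rewrite -[x]quantic_wordK quantic_mulE cats0. Qed.

HB.instance Definition _ :=
  isMonoid.Build U quantic_mulA quantic_mul1 quantic_mulr1.

Definition quantic_gen (i : I) : U := quantic_class [:: i].

(* (x), meaningful for x in Q^+ only: negative coordinates are replaced by
   their absolute values. *)
Definition quantic_elt (x : root_lattice I) : U :=
  (\prod_(i <- Order.enum I) quantic_gen i ^+ `|x i|%N)%g.

End QuanticMonoid.

(* Main.v *)
Require Import Defs.
From mathcomp Require Import all_boot all_order all_algebra.
From mathcomp Require Import finmap.
From mathcomp Require Import zify ring.

Set Implicit Arguments.
Unset Strict Implicit.
Unset Printing Implicit Defensive.

Import Order.TTheory GRing.Theory Num.Theory.

(** The order on I is an acyclic orientation of the Dynkin diagram, and only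
    the condition <v, u> >= 0 between the parts u of d and v of e matters.  Let
    n be the last element of I.
    - If alpha_n is a part of e, it can be split off on the right of (e).  If it
      is a part of d, it can first be moved across (e), because
      n * (e) = (e) * n as soon as <e, alpha_n> >= 0.  Both cases reduce the
      number of parts.
    - Otherwise s_n permutes the positive roots involved, and preserves the
      Euler form provided that n is made the first element of the order.  A
      finite transducer on words carries any equality of words for the new order
      to one for the old order, and sends (s_n x) to (x); so the claim for
      s_n d and s_n e implies the claim for d and e.
    Going through the elements of I cyclically, the second case cannot occur
    forever: the orbit of a root under the Coxeter element c is finite, and c has
    no nonzero fixed vector, so the orbit does not stay in Q^+. *)

(** * Words modulo the quantic relations of an arbitrary ordering *)

(** The pairs (a_ij, a_ji) that occur in finite type. The transducer below relies on no other
    property of [C]. *)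
Definition rank2_entries : seq (int * int) :=
  [:: (0, 0); (-1, -1); (-1, -2); (-2, -1); (-1, -3); (-3, -1)]%R.

Section Congruence.

Context (I : eqType) (C : I -> I -> int).

(** The order on I is replaced by the position in a list [s], so that the ordering can be
    rotated. *)
Inductive word_cong (s : seq I) : seq I -> seq I -> Prop :=
  | word_rel i j p q r t of (index i s < index j s)%N
      & infix [:: (p, q); (r, t)] (rank2_list (C i j) (C j i)) :
      word_cong s (nseq p i ++ nseq q j ++ nseq r i ++ nseq t j)
                  (nseq (p + r)%N i ++ nseq (q + t)%N j)
  | word_refl u : word_cong s u u
  | word_sym u v : word_cong s u v -> word_cong s v u
  | word_trans v u w : word_cong s u v -> word_cong s v w -> word_cong s u w
  | word_cat u u' v v' :
      word_cong s u u' -> word_cong s v v' -> word_cong s (u ++ v) (u' ++ v').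

Lemma word_ctx s x y u v :
  word_cong s u v -> word_cong s (x ++ u ++ y) (x ++ v ++ y).
Proof.
by move=> h; apply: word_cat; [exact: word_refl|apply: word_cat h (word_refl _ _)].
Qed.

Lemma word_catl s x u v : word_cong s u v -> word_cong s (x ++ u) (x ++ v).
Proof. exact/word_cat/word_refl. Qed.

Lemma word_catr s y u v : word_cong s u v -> word_cong s (u ++ y) (v ++ y).
Proof. by move=> h; apply: word_cat h (word_refl _ _). Qed.

End Congruence.

(** * Moving the first letter n of the ordering n :: s to the end *)

Section Transducer.

Context (I : eqType) (C : I -> I -> int) (n : I) (s : seq I).
Hypothesis n_notin : n \notin s.
Hypothesis s_full : forall j, j != n -> j \in s.
Hypothesis rank2 : forall j, j != n -> (C j n, C n j) \in rank2_entries.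

Local Notation "u ~~> v" := (word_cong C (rcons s n) u v) (at level 70).

Definition pivot_coef (j : I) : nat := `|C n j|%N.
Local Notation c := pivot_coef.

Lemma index_pivot j : j != n -> (index j (rcons s n) < index n (rcons s n))%N.
Proof.
move=> jn; rewrite -cats1 !index_cat (negPf n_notin) s_full //= eqxx addn0.
by rewrite index_mem s_full.
Qed.

Lemma index_rotate i j : i != n -> j != n ->
  (index i (rcons s n) < index j (rcons s n))%N =
  (index i (n :: s) < index j (n :: s))%N.
Proof.
move=> iN jN; rewrite -cats1 !index_cat !s_full //=.
by rewrite !(eq_sym n) (negPf iN) (negPf jN).
Qed.

Lemma pivot_rel j p q r t : j != n ->
  infix [:: (p, q); (r, t)] (rank2_list (C j n) (C n j)) ->
  nseq p j ++ nseq q n ++ nseq r j ++ nseq t n ~~>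
  nseq (p + r)%N j ++ nseq (q + t)%N n.
Proof. by move=> jn; apply: word_rel; exact: index_pivot. Qed.

(** In each type the list L_jn begins with (0, 1), (1, c_j), which gives n j n^(c_j) = j n^(c_j +
    1). This is applied once for each of the a letters n. *)
Lemma push_letter a j : j != n ->
  nseq a n ++ j :: nseq (c j) n ~~> j :: nseq (c j + a) n.
Proof.
move=> jn; elim: a => [|a IH]; first by rewrite addn0; exact: word_refl.
rewrite -[X in nseq X n ++ _]addn1 nseqD -catA.
apply: word_trans (word_catl (nseq a n) _) _.
  have := @pivot_rel j 0 1 1 (c j) jn; apply.
  rewrite /c /pivot_coef; move: (rank2 jn).
  by rewrite /rank2_entries !inE => /orP[|/orP[|/orP[|/orP[|/orP[|]]]]] /eqP[-> ->].
have -> : nseq (0 + 1) j ++ nseq (1 + c j) n = (j :: nseq (c j) n) ++ [:: n].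
  by rewrite [(1 + c j)%N]addnC (nseqD (c j) 1).
rewrite catA; apply: word_trans (word_catr _ IH) _.
by rewrite addnS -(addn1 (c j + a)) (nseqD (c j + a) 1); exact: word_refl.
Qed.

(* With c = c_j, the letters n^m j for n minimal correspond to j n^(c-m) for n
   maximal (0 <= m <= c).  The counter t holds the letters n not yet absorbed by
   a letter on their right; those left over at the end are the overflow. *)
Fixpoint trans (t : nat) (w : seq I) : seq I :=
  if w is x :: w' then
    if x == n then trans t.+1 w' else x :: nseq (c x - t) n ++ trans (t - c x) w'
  else [::].

Fixpoint overflow (t : nat) (w : seq I) : nat :=
  if w is x :: w' then
    if x == n then overflow t.+1 w' else overflow (t - c x) w'
  else t.

Lemma trans_cat t u v : trans t (u ++ v) = trans t u ++ trans (overflow t u) v.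
Proof.
elim: u t => //= x u IH t; case: ifP => _; first exact: IH.
by rewrite IH catA.
Qed.

Lemma overflow_cat t u v : overflow t (u ++ v) = overflow (overflow t u) v.
Proof. by elim: u t => //= x u IH t; case: ifP. Qed.

Lemma trans_pivot t p w : trans t (nseq p n ++ w) = trans (t + p) w.
Proof. by elim: p t => [|p IH] t /=; rewrite ?addn0 // eqxx IH addSnnS. Qed.

Lemma overflow_pivot t p w : overflow t (nseq p n ++ w) = overflow (t + p) w.
Proof. by elim: p t => [|p IH] t /=; rewrite ?addn0 // eqxx IH addSnnS. Qed.

Definition capacity (w : seq I) : nat := \sum_(x <- w) c x.

Lemma push_word a w : n \notin w ->
  nseq a n ++ w ++ nseq (capacity w) n ~~> w ++ nseq (capacity w + a) n.
Proof.
rewrite /capacity; elim: w a => [|j w IH] a.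
  by rewrite big_nil add0n cats0 => _; exact: word_refl.
rewrite in_cons negb_or eq_sym big_cons => /andP[jn nw].
set m := \sum_(x <- w) c x in IH *.
(* The induction hypothesis, read backwards, fetches c_j letters n from the right end and places
   them just behind j, where [push_letter] needs them. *)
apply: (@word_trans _ _ _ (nseq a n ++ j :: nseq (c j) n ++ w ++ nseq m n)).
  apply: word_catl; apply: (@word_catl _ _ _ [:: j]); apply: word_sym.
  by rewrite [(c j + m)%N]addnC; exact: IH.
rewrite -cat_cons catA; apply: word_trans (word_catr _ (push_letter a jn)) _.
rewrite cat_cons; apply: (@word_catl _ _ _ [:: j]).
by rewrite [(c j + m)%N]addnC -addnA; exact: IH.
Qed.

Lemma overflow_nonpivot t w : n \notin w -> overflow t w = (t - capacity w)%N.
Proof.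
rewrite /capacity; elim: w t => [|j w IH] t /=; first by rewrite big_nil subn0.
rewrite in_cons negb_or eq_sym => /andP[/negPf -> nw].
by rewrite IH // big_cons subnDA.
Qed.

(** Once a letter is not saturated by the counter, the counter is 0 and every later letter x emits
    its full c_x letters n. By [push_word] these let the earlier emitted n pass to the right end. *)
Lemma trans_nonpivot t w : n \notin w ->
  trans t w ~~> w ++ nseq (capacity w - t) n.
Proof.
elim: w t => [|j w IH] t /=; first by rewrite /capacity big_nil => _; exact: word_refl.
rewrite in_cons negb_or eq_sym => /andP[/negPf -> nw].
apply: (@word_catl _ _ _ [:: j]); apply: word_trans (word_catl _ (IH _ nw)) _.
have -> : capacity (j :: w) = (c j + capacity w)%N by rewrite /capacity big_cons.
have [cjt|tcj] := leqP (c j) t.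
  move: (cjt); rewrite -subn_eq0 => /eqP -> /=.
  by rewrite subnBA // addnC; exact: word_refl.
have -> : (t - c j = 0)%N by apply/eqP; rewrite subn_eq0 ltnW.
by rewrite subn0 addnC -addnBA ?(ltnW tcj) //; exact: push_word.
Qed.

Lemma capacity_cat u v : capacity (u ++ v) = (capacity u + capacity v)%N.
Proof. by rewrite /capacity big_cat. Qed.

Lemma capacity_nseq k j : capacity (nseq k j) = (k * c j)%N.
Proof. by rewrite /capacity big_nseq iter_addn_0 mulnC. Qed.

(* For a = q c_j - p this is the image of a defining relation under s_n; smaller
   values of a occur when letters n standing further left have been absorbed. *)
Lemma pivot_rank2 j p q r t a : j != n ->
  infix [:: (p, q); (r, t)] (rank2_list (C n j) (C j n)) ->
  (q * c j <= p)%N \/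
  (r <= t * c j)%N /\
  (a <= q * c j - p ->
   nseq q j ++ nseq a n ++ nseq t j ++ nseq (t * c j - r) n ~~>
   nseq (q + t) j ++ nseq (a + (t * c j - r)) n)%N.
Proof.
move=> jn.
have rel x y p' q' r' t' :
    infix [:: (p', q'); (r', t')] (rank2_list (C j n) (C n j)) ->
    x ++ (nseq p' j ++ nseq q' n ++ nseq r' j ++ nseq t' n) ++ y ~~>
    x ++ (nseq (p' + r') j ++ nseq (q' + t') n) ++ y.
  by move=> h; apply: word_ctx; exact: pivot_rel.
pose Q (x y : nat * nat) := (x.2 * c j <= x.1)%N \/ (y.1 <= y.2 * c j)%N /\
  (a <= x.2 * c j - x.1 ->
   nseq x.2 j ++ nseq a n ++ nseq y.2 j ++ nseq (y.2 * c j - y.1) n ~~>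
   nseq (x.2 + y.2) j ++ nseq (a + (y.2 * c j - y.1)) n)%N.
(* Consecutive entries are addressed by position, which leaves finitely many explicit cases. *)
suff HQ l : l = rank2_list (C n j) (C j n) ->
    forall i, (i.+1 < size l)%N -> Q (nth (0, 0) l i) (nth (0, 0) l i.+1).
  move=> /infixP[x [y /esym E]]; have := HQ _ E (size x).
  rewrite !nth_cat ltnn subnn [((size x).+1 < size x)%N]ltnNge leqnSn subSnn.
  by apply; rewrite !size_cat /=; lia.
move: rel (rank2 jn).
rewrite {}/Q /c /pivot_coef /rank2_entries !inE /rank2_list => rel.
do 5?[case/orP]; case/eqP=> Ejn Enj; move: rel; rewrite Ejn Enj /= => rel ->.
all: do 7?[case=> [_|//]] => //=.
(* The first alternative holds exactly for the last pair of each list, whose second entry (1, 0) is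
   the simple root of n. *)
all: try by left.
all: right; split=> //; case: a => [|[|[|[|?]]]] // _; first exact: word_refl.
all: try exact: (rel [::] [::] 1 1 1 0 isT).
all: try exact: (rel [::] [::] 1 1 2 1 isT).
all: try exact: (rel [::] [::] 2 1 1 0 isT).
all: try exact: (rel [::] [::] 1 1 3 2 isT).
all: try exact: (rel [::] [::] 3 2 2 1 isT).
all: try exact: (rel [::] [::] 2 1 2 1 isT).
all: try exact: (rel [::] [::] 2 1 3 1 isT).
all: try exact: (rel [::] [::] 3 1 1 0 isT).
all: try exact: (rel [::] [::] 1 2 1 1 isT).
all: try exact: (rel [::] [::] 1 3 1 2 isT).
all: try exact: (rel [::] [::] 1 2 1 2 isT).
all: try exact: (rel [::] [::] 1 2 2 3 isT).
all: try exact: (rel [::] [::] 2 3 1 1 isT).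
all: try exact: (rel [::] [:: n] 1 1 1 0 isT).
all: try exact: (rel [::] [:: n; n] 1 1 1 0 isT).
(* What remains are four cases of type G2 with a below q c_j - p: there the relation has to be
   applied inside a longer word, or several times. *)
- apply: word_trans (rel [::] [:: j; n; n; n] 1 1 1 0 isT) _.
  exact: (rel [:: j] [:: n; n; n] 1 1 1 0 isT).
- exact: (rel [:: j] [:: n] 1 1 1 0 isT).
- apply: word_trans (word_sym (rel [::] [:: n; j; n] 1 1 1 0 isT)) _.
  apply: word_trans (rel [:: j; n] [:: n] 1 1 1 0 isT) _.
  apply: word_trans (rel [::] [:: j; n; n] 1 1 1 0 isT) _.
  exact: (rel [:: j] [:: n; n] 1 1 1 0 isT).
- exact: (rel [:: j] [::] 2 1 2 1 isT).
Qed.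

Lemma notin_nseq k j : j != n -> n \notin nseq k j.
Proof. by move=> jn; rewrite mem_nseq negb_and eq_sym jn orbT. Qed.

(** It suffices to treat the generators of the congruence, but with an arbitrary initial counter,
    since a factor may be preceded by unabsorbed letters n. Equal overflows make the claim
    compatible with concatenation. *)
Lemma trans_cong u v : word_cong C (n :: s) u v ->
  forall t, overflow t u = overflow t v /\ trans t u ~~> trans t v.
Proof.
elim=> {u v}.
- move=> i j p q r t ltij hinf k.
  (* The letter n comes first in n :: s, so it can only be the smaller letter of a relation. *)
  have jn : j != n by apply: contraTneq ltij => ->; rewrite /= eqxx.
  have [Ei|iN] := eqVneq i n; last first.
    have ltij' : (index i (rcons s n) < index j (rcons s n))%N by rewrite index_rotate.
    set u := nseq p i ++ _; set v := nseq (p + r) i ++ _.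
    have nu : n \notin u by rewrite !mem_cat !negb_or !notin_nseq.
    have nv : n \notin v by rewrite !mem_cat !negb_or !notin_nseq.
    have uv : capacity u = capacity v.
      by rewrite !capacity_cat !capacity_nseq; lia.
    rewrite !overflow_nonpivot // uv; split=> //.
    apply: word_trans (trans_nonpivot _ nu) _.
    apply: word_trans (word_sym (trans_nonpivot _ nv)).
    by rewrite uv; apply: word_catr; exact: word_rel.
  subst i; have njs m : n \notin nseq m j by exact: notin_nseq.
  rewrite !trans_pivot !overflow_pivot !(trans_cat _ (nseq q j)).
  rewrite !(overflow_cat _ (nseq q j)) !overflow_pivot.
  rewrite !trans_pivot !overflow_nonpivot // !capacity_nseq.
  (* After k + p letters n have been counted, the block j^q emits this many letters n. *)
  have H := @pivot_rank2 j p q r t (q * c j - (k + p)) jn hinf.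
  split; first by case: H => [|[? _]]; lia.
  apply: word_trans (word_sym (trans_nonpivot _ (njs _))).
  apply: word_trans (word_cat (trans_nonpivot _ (njs _)) (trans_nonpivot _ (njs _))) _.
  rewrite !capacity_nseq -!catA.
  have [le1|lt1] := leqP (q * c j) (k + p).
    have -> : (q * c j - (k + p) = 0)%N by apply/eqP; rewrite subn_eq0.
    rewrite /= catA -nseqD; apply: word_catl.
    have -> : (t * c j - (k + p - q * c j + r) = (q + t) * c j - (k + (p + r)))%N by lia.
    exact: word_refl.
  case: H => [|[le2 H]]; first by lia.
  have -> : (k + p - q * c j + r = r)%N by lia.
  have -> : ((q + t) * c j - (k + (p + r)) = q * c j - (k + p) + (t * c j - r))%N by lia.
  by apply: H; lia.
- by move=> u t; split=> //; exact: word_refl.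
- by move=> u v _ IH t; have [? ?] := IH t; split=> //; exact: word_sym.
- move=> v u w _ IH1 _ IH2 t; have [e1 h1] := IH1 t; have [e2 h2] := IH2 t.
  by rewrite e1 e2; split=> //; exact: word_trans h2.
- move=> u u' v v' _ IH1 _ IH2 t; have [e1 h1] := IH1 t.
  have [e2 h2] := IH2 (overflow t u').
  by rewrite !overflow_cat !trans_cat e1; split=> //; exact: word_cat.
Qed.
End Transducer.

Local Open Scope ring_scope.

(** * The Cartan and Euler forms *)

Section CartanForm.

Context (disp : Order.disp_t) (I : finOrderType disp).
Context (C : I -> I -> int) (D : I -> nat).
Hypothesis cartanC : cartan_matrix C.
Hypothesis symC : symmetrizer C D.
Hypothesis posC : symmetrized_posdef C D.

Local Notation Q := (root_lattice I).
Local Notation refl := (simple_reflection C).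

Definition coroot_pairing (i : I) (x : I -> int) : int := \sum_j x j * C i j.

Definition cartan_form (x y : I -> int) : int :=
  \sum_i \sum_j x i * ((D i)%:Z * C i j) * y j.

Local Notation bf := cartan_form.

Lemma simple_reflectionE i (x : Q) j :
  refl i x j = x j - (j == i)%:Z * coroot_pairing i x.
Proof.
rewrite /simple_reflection /coroot_pairing; set k := \sum_j _.
have mulE (u : Q) : (u *~ k) j = u j * k.
  case: k => k; first by rewrite -pmulrn ffunMnE pmulrn mulrzz.
  by rewrite NegzE mulrNz ffunE -pmulrn ffunMnE pmulrn mulrzz mulrN.
by rewrite 2!ffunE mulE ffunE.
Qed.

Lemma sum_delta i (F : I -> int) : \sum_j (j == i)%:Z * F j = F i.
Proof.
rewrite (bigD1 i) //= eqxx big1 ?addr0 ?mul1r // => j /negPf ->.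
by rewrite mul0r.
Qed.

Lemma eq_cartan_form x x' y y' : x =1 x' -> y =1 y' -> bf x y = bf x' y'.
Proof.
by move=> ex ey; apply: eq_bigr => i _; apply: eq_bigr => j _; rewrite ex ey.
Qed.

Lemma cartan_form_sym x y : bf x y = bf y x.
Proof.
rewrite /bf exchange_big; apply: eq_bigr => i _; apply: eq_bigr => j _.
by rewrite symC.2; ring.
Qed.

Lemma cartan_form_linl a b x y z :
  bf (fun i => a * x i + b * y i) z = a * bf x z + b * bf y z.
Proof.
rewrite /bf !mulr_sumr -big_split; apply: eq_bigr => i _.
rewrite !mulr_sumr -big_split; apply: eq_bigr => j _ /=; ring.
Qed.

Lemma cartan_form_linr a b x y z :
  bf z (fun i => a * x i + b * y i) = a * bf z x + b * bf z y.
Proof. by rewrite cartan_form_sym cartan_form_linl !(cartan_form_sym z). Qed.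

Lemma cartan_form_simple i x :
  bf x (fun j => (j == i)%:Z) = (D i)%:Z * coroot_pairing i x.
Proof.
rewrite /bf mulr_sumr; apply: eq_bigr => j _.
under eq_bigr => k _ do rewrite mulrC.
by rewrite sum_delta symC.2; ring.
Qed.

Lemma cartan_form_reflection i (x : Q) : bf (refl i x) (refl i x) = bf x x.
Proof.
set k := coroot_pairing i x; set e := fun j => (j == i)%:Z.
have E : refl i x =1 (fun j => 1 * x j + (- k) * e j).
  by move=> j; rewrite simple_reflectionE -/k /e; ring.
rewrite (eq_cartan_form E E) cartan_form_linl !cartan_form_linr.
rewrite (cartan_form_sym e x) !cartan_form_simple -/k.
have -> : coroot_pairing i e = 2.
  by rewrite /coroot_pairing sum_delta cartanC.1.
ring.
Qed.

Lemma cartan_form_gt0 x : (exists i, x i != 0) -> 0 < bf x x.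
Proof.
case=> i xi; rewrite -(ltr0z rat).
have -> : (bf x x)%:~R = \sum_a \sum_b
    (x a)%:~R * ((D a)%:Z * C a b)%:~R * (x b)%:~R :> rat.
  rewrite rmorph_sum; apply: eq_bigr => a _.
  by rewrite rmorph_sum; apply: eq_bigr => b _; rewrite !rmorphM.
by apply: posC; exists i; rewrite intr_eq0.
Qed.

Lemma cartan_form_ge0 x : 0 <= bf x x.
Proof.
have [/existsP[i xi]|/existsPn H] := boolP [exists i, x i != 0].
  by apply/ltW/cartan_form_gt0; exists i.
rewrite /bf big1 // => i _; rewrite big1 // => j _.
by move: (H i); rewrite negbK => /eqP ->; rewrite mul0r mul0r.
Qed.

Lemma cartan_form_CS x y : bf x y ^+ 2 <= bf x x * bf y y.
Proof.
have [/existsP[i yi]|/existsPn H] := boolP [exists i, y i != 0]; last first.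
  have y0 z : bf z y = 0.
    rewrite /bf big1 // => i _; rewrite big1 // => j _.
    by move: (H j); rewrite negbK => /eqP ->; rewrite mulr0.
  by rewrite !y0 mulr0.
have y_gt0 : 0 < bf y y by apply: cartan_form_gt0; exists i.
have := cartan_form_ge0 (fun i => bf y y * x i + (- bf x y) * y i).
rewrite cartan_form_linl !cartan_form_linr (cartan_form_sym y x) => H.
rewrite -(ler_pM2l y_gt0) -subr_ge0; apply: le_trans H _.
by rewrite le_eqVlt; apply/orP; left; apply/eqP; ring.
Qed.

(** The vector x = -a_ij alpha_i + 2 alpha_j has (x, x) = 2 d_j (4 - a_ij a_ji), so a_ij a_ji <
    4. *)
Lemma rank2_cartan i j : i != j ->
  (C i j, C j i) \in rank2_entries.
Proof.
move=> ij; have ji : j != i by rewrite eq_sym.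
have := cartanC.2 _ _ ij; have := cartanC.2 _ _ ji; have := symC.2 i j.
have := symC.1 i; have := symC.1 j.
pose x k : int := (k == i)%:Z * (- C i j) + (k == j)%:Z * 2.
have : 0 < bf x x.
  by apply: cartan_form_gt0; exists j; rewrite /x (negPf ji) eqxx mul0r add0r mul1r.
have E : x =1 (fun k => (- C i j) * (k == i)%:Z + 2 * (k == j)%:Z).
  by move=> k; rewrite /x; ring.
rewrite (eq_cartan_form E E) cartan_form_linl !cartan_form_linr !cartan_form_simple.
have p a b : coroot_pairing a (fun k => (k == b)%:Z) = C a b.
  exact: sum_delta.
rewrite !p !cartanC.1.
move: (C i j) (C j i) (D i) (D j) => a b d e h e0 d0 E1 b0 a0.
have ab : a * b < 4.
  have : 0 < 2 * e%:Z * (4 - a * b).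
    by move: h; rewrite -E1; nia.
  by rewrite pmulr_rgt0; lia.
have [a0'|a1] := eqVneq a 0.
  have -> : b = 0 by move: E1; rewrite a0'; nia.
  by rewrite a0'.
have [b0'|b1] := eqVneq b 0; first by exfalso; move: E1; rewrite b0'; nia.
have [k1 Ea] : exists k : nat, a = - k%:Z by exists `|a|%N; lia.
have [k2 Eb] : exists k : nat, b = - k%:Z by exists `|b|%N; lia.
subst a b; move: ab a1 b1; clear.
case: k1 => [|[|[|[|k1]]]]; case: k2 => [|[|[|[|k2]]]] => //; lia.
Qed.

(** The Euler form for the ordering listed by [s]; for the increasing list of I it is
    [euler_form]. *)
Fixpoint list_euler (s : seq I) (x y : I -> int) : int :=
  if s is i :: s' then
    (D i)%:Z * x i * y i + \sum_(j <- s') x i * y j * ((D i)%:Z * C i j)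
    + list_euler s' x y
  else 0.

Local Notation eul := list_euler.

Definition ordering (s : seq I) := uniq s /\ forall i, i \in s.

Lemma sum_ordering s (F : I -> int) :
  ordering s -> \sum_j F j = \sum_(j <- s) F j.
Proof.
by case=> us fs; rewrite [RHS]big_uniq //; apply: eq_bigl => i; rewrite fs.
Qed.

Lemma cartan_form_euler s x : ordering s -> bf x x = 2 * eul s x x.
Proof.
move=> os; rewrite /bf (sum_ordering _ os).
under eq_bigr => i _ do rewrite (sum_ordering _ os).
elim: s {os} => [|i s IH] /=; first by rewrite !big_nil mulr0.
rewrite !big_cons; under [X in _ + X]eq_bigr => j _ do rewrite big_cons.
rewrite big_split /= IH cartanC.1.
have -> : \sum_(j <- s) x j * ((D j)%:Z * C j i) * x i =
          \sum_(j <- s) x i * x j * ((D i)%:Z * C i j).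
  by apply: eq_bigr => j _; rewrite symC.2; ring.
have -> : \sum_(j <- s) x i * ((D i)%:Z * C i j) * x j =
          \sum_(j <- s) x i * x j * ((D i)%:Z * C i j).
  by apply: eq_bigr => j _; ring.
ring.
Qed.

(** Each term contains a factor d_i x_i. Together with [cartan_form_euler] this makes (x, x) a
    multiple of 2m. *)
Lemma dvdz_list_euler m s x :
  (forall j, (m %| (D j)%:Z * x j)%Z) -> (m %| eul s x x)%Z.
Proof.
move=> mx; elim: s => [|i s IH] /=; first exact: dvdz0.
rewrite rpredD //; rewrite rpredD //; first by rewrite dvdz_mulr.
apply: rpred_sum => j _.
have -> : x i * x j * ((D i)%:Z * C i j) = ((D i)%:Z * x i) * (x j * C i j) by ring.
by rewrite dvdz_mulr.
Qed.

(* The second condition says that x / m lies in the coroot lattice. *)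
Definition rootlike (x : I -> int) := exists m : int,
  [/\ 0 < m, bf x x = 2 * m & forall j, (m %| (D j)%:Z * x j)%Z].

Lemma rootlike_reflection i (x : Q) : rootlike x -> rootlike (refl i x).
Proof.
case=> m [m0 xm mx]; exists m; split=> //; first by rewrite cartan_form_reflection.
move=> j; rewrite simple_reflectionE; have [->|ji] := eqVneq j i; last first.
  by rewrite mul0r subr0.
rewrite mul1r mulrBr rpredB // /coroot_pairing mulr_sumr; apply: rpred_sum => k _.
have -> : (D i)%:Z * (x k * C i k) = ((D k)%:Z * x k) * C k i.
  by rewrite mulrCA symC.2; ring.
by rewrite dvdz_mulr.
Qed.

Lemma rootlike_root x : is_root C x -> rootlike x.
Proof.
elim=> {x} [i|i x _]; last exact: rootlike_reflection.
have E : simple_root i =1 (fun j => (j == i)%:Z) by move=> j; rewrite ffunE.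
exists (D i)%:Z; split; first by rewrite ltz_nat symC.1.
  rewrite (eq_cartan_form E E) cartan_form_simple /coroot_pairing sum_delta.
  by rewrite cartanC.1 mulrC.
move=> j; rewrite E; have [->|_] := eqVneq j i; first by rewrite dvdz_mulr.
by rewrite mulr0 dvdz0.
Qed.

(* Writing x = p - q with p, q >= 0 of disjoint supports, both (p, p) and
   (q, q) are multiples of 2m = (x, x), while (p, p) + (q, q) <= (x, x). *)
Lemma rootlike_sign x : rootlike x ->
  (forall i, 0 <= x i) \/ (forall i, x i <= 0).
Proof.
case=> m [m0 xm mx]; pose p i := Num.max (x i) 0; pose q i := Num.max (- x i) 0.
have [/forallP|/forallPn[a]] := boolP [forall i, 0 <= x i]; first by left.
rewrite -ltNge => xa.
have [/forallP|/forallPn[b]] := boolP [forall i, x i <= 0]; first by right.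
rewrite -ltNge => xb; exfalso.
have os : ordering (enum I) by split; [exact: enum_uniq|move=> i; rewrite mem_enum].
have large y : (forall j, (m %| (D j)%:Z * y j)%Z) -> (exists i, y i != 0) ->
    2 * m <= bf y y.
  move=> /(dvdz_list_euler (enum I)) /dvdzP[k Ek] /cartan_form_gt0.
  rewrite (cartan_form_euler _ os) Ek pmulr_rgt0 // pmulr_lgt0 // => k0.
  by rewrite ler_pM2l // ler_pMl //; lia.
have p_large : 2 * m <= bf p p.
  apply: large; last by exists b; rewrite /p; lia.
  by move=> j; rewrite /p maxEle; case: ifP => // _; rewrite mulr0 dvdz0.
have q_large : 2 * m <= bf q q.
  apply: large; last by exists a; rewrite /q; lia.
  move=> j; rewrite /q maxEle; case: ifP => _; first by rewrite mulr0 dvdz0.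
  by rewrite mulrN rpredN.
(* The supports are disjoint, so only off-diagonal Cartan entries contribute. Hence (x, x) >= (p, p)
   + (q, q) >= 4m, against (x, x) = 2m. *)
have pq_le0 : bf p q <= 0.
  rewrite /bf; apply: sumr_le0 => i _; apply: sumr_le0 => j _.
  have [<-|ij] := eqVneq i j.
    have -> : p i * ((D i)%:Z * C i i) * q i = (p i * q i) * ((D i)%:Z * C i i) by ring.
    have -> : p i * q i = 0 by rewrite /p /q; case: (lerP (x i) 0) => h; nia.
    by rewrite mul0r.
  have p0 : 0 <= p i by rewrite /p le_max lexx orbT.
  have q0 : 0 <= q j by rewrite /q le_max lexx orbT.
  by rewrite mulr_le0_ge0 // mulr_ge0_le0 // mulr_ge0_le0 // cartanC.2.
have E : x =1 (fun i => 1 * p i + (-1) * q i) by move=> i; rewrite /p /q; lia.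
move: xm; rewrite (eq_cartan_form E E) cartan_form_linl !cartan_form_linr.
rewrite (cartan_form_sym q p); lia.
Qed.

(** Otherwise s_i x <= 0 by [rootlike_sign]. As s_i changes only the coordinate at i, x = a alpha_i.
    Then m = a^2 d_i divides d_i a, which forces a = 1. *)
Lemma reflection_Qplus i (x : Q) :
  rootlike x -> x \in Qplus I -> x != simple_root i -> refl i x \in Qplus I.
Proof.
move=> xr /forallP x0 xi; apply/forallP.
case: (rootlike_sign (rootlike_reflection i xr)) => // le0; exfalso.
have xj j : j != i -> x j = 0.
  move=> ji; apply/eqP; rewrite eq_le x0 andbT.
  by move: (le0 j); rewrite simple_reflectionE (negPf ji) mul0r subr0.
have E : x =1 (fun j => x i * (j == i)%:Z + 0 * (j == i)%:Z).
  by move=> j; rewrite mul0r addr0; have [->|/xj ->] := eqVneq j i; rewrite ?mulr1 ?mulr0.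
case: xr => m [m0 + /(_ i) /dvdzP[k Ek]].
rewrite (eq_cartan_form E E) cartan_form_linl !cartan_form_linr !cartan_form_simple.
rewrite /coroot_pairing sum_delta cartanC.1 => xm.
case/eqP: xi; apply/ffunP => j; rewrite ffunE.
have [->|/xj //] := eqVneq j i.
have := x0 i; have := symC.1 i; move: xm Ek m0; clear.
move: (x i) (D i) => a d xm Ek m0 d0 a0.
have Em : m = a * a * d%:Z by lia.
have a_gt0 : 0 < a by rewrite lt_neqAle a0 andbT; apply: contraTneq m0 => Ea; lia.
have Ek' : d%:Z * a * 1 = d%:Z * a * (k * a) by rewrite mulr1 [LHS]Ek Em; ring.
have da0 : d%:Z * a != 0 by rewrite mulf_neq0 //; lia.
have ka := mulfI da0 Ek'.
have k0 : 0 < k by rewrite -(pmulr_lgt0 _ a_gt0) -ka.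
by move: a_gt0 k0 ka; clear; nia.
Qed.

(** * The Euler form under reflection and rotation of the ordering *)

Lemma list_euler_rcons s n x y : eul (rcons s n) x y =
  eul s x y + (D n)%:Z * y n * (\sum_(j <- s) x j * C n j) + (D n)%:Z * x n * y n.
Proof.
elim: s => [|i s IH] /=; first by rewrite !big_nil; ring.
by rewrite IH big_rcons big_cons /= symC.2; ring.
Qed.

Lemma coroot_pairing_ordering n s x : ordering (n :: s) ->
  coroot_pairing n x = 2 * x n + \sum_(j <- s) x j * C n j.
Proof.
by move=> os; rewrite /coroot_pairing (sum_ordering _ os) big_cons cartanC.1 mulrC.
Qed.

Lemma eq_list_euler s x x' y y' : {in s, x =1 x'} -> {in s, y =1 y'} ->
  eul s x y = eul s x' y'.
Proof.
elim: s => //= i s IH ex ey; rewrite ex ?ey ?mem_head //.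
rewrite IH => [|j js|j js]; rewrite ?ex ?ey ?in_cons ?js ?orbT //.
by congr (_ + _ + _); rewrite !big_seq; apply: eq_bigr => j js;
  rewrite ey // in_cons js orbT.
Qed.

(** Let S z be the sum of the z_j a_nj over [s], so that z'_n = -z_n - S z for z' = s_n z. The terms
    of n on the left are d_n x'_n (y'_n + S y) = d_n (x_n + S x) y_n, the terms of n when it stands
    last. *)
Lemma list_euler_reflection n s (x y : Q) : ordering (n :: s) ->
  eul (n :: s) (refl n x) (refl n y) = eul (rcons s n) x y.
Proof.
move=> os; have ns : n \notin s by case: os => /= /andP[].
have off (z : Q) : {in s, refl n z =1 z}.
  move=> j js; rewrite simple_reflectionE.
  have [jn|_] := eqVneq j n; first by rewrite -jn js in ns.
  by rewrite mul0r subr0.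
have at_n (z : Q) : refl n z n = - z n - \sum_(j <- s) z j * C n j.
  by rewrite simple_reflectionE eqxx mul1r (coroot_pairing_ordering _ os); ring.
rewrite list_euler_rcons [LHS]/= (eq_list_euler (off x) (off y)) !at_n.
have -> : \sum_(j <- s) (- x n - \sum_(k <- s) x k * C n k) * refl n y j *
    ((D n)%:Z * C n j) = (D n)%:Z * (- x n - \sum_(k <- s) x k * C n k) *
    \sum_(k <- s) y k * C n k.
  rewrite mulr_sumr !big_seq; apply: eq_bigr => j js; rewrite off //; ring.
ring.
Qed.

Lemma list_euler_sum s x (B : seq Q) :
  eul s (\sum_(v <- B) v) x = \sum_(v <- B) eul s v x.
Proof.
elim: B => [|v B IH]; rewrite ?big_nil ?big_cons -?IH.
  elim: s => //= i s ->; rewrite ffunE mulr0 mul0r !add0r addr0 big1 // => j _.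
  by rewrite !mul0r.
move: (\sum_(u <- B) u) => w; elim: s {IH} => //= i s ->; rewrite ffunE.
have -> : \sum_(j <- s) (v i + w i) * x j * ((D i)%:Z * C i j) =
  \sum_(j <- s) v i * x j * ((D i)%:Z * C i j) +
  \sum_(j <- s) w i * x j * ((D i)%:Z * C i j).
  by rewrite -big_split; apply: eq_bigr => j _ /=; ring.
ring.
Qed.

Lemma list_euler_sorted s x y : sorted <%O s ->
  eul s x y = \sum_(i <- s) \sum_(j <- s) x i * y j * euler_simple C D i j.
Proof.
elim: s => [|i s IH] /=; first by rewrite big_nil.
move=> ps; have si : all (fun j => i < j)%O s by exact: order_path_min lt_trans ps.
rewrite !big_cons (IH (path_sorted ps)).
under [X in _ = _ + X]eq_bigr => j _ do rewrite big_cons.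
rewrite big_split /=.
have -> : \sum_(j <- s) x j * y i * euler_simple C D j i = 0.
  rewrite big_seq big1 // => j /(allP si) ij.
  by rewrite /euler_simple ltNge (ltW ij) (gt_eqF ij) mulr0.
have -> : euler_simple C D i i = (D i)%:Z by rewrite /euler_simple ltxx eqxx.
rewrite add0r; congr (_ + _ + _); first by ring.
rewrite !big_seq; apply: eq_bigr => j /(allP si) ij.
by rewrite /euler_simple ij.
Qed.

End CartanForm.

(** * The Coxeter element leaves the positive cone *)

Section Coxeter.

Context (disp : Order.disp_t) (I : finOrderType disp).
Context (C : I -> I -> int) (D : I -> nat).
Hypothesis cartanC : cartan_matrix C.
Hypothesis symC : symmetrizer C D.
Hypothesis posC : symmetrized_posdef C D.

Local Notation Q := (root_lattice I).
Local Notation refl := (simple_reflection C).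
Local Notation bf := (cartan_form C D).

(** The Gram matrix is nonsingular by definiteness; a row of its adjugate is an integral dual
    vector, scaled by N = det. *)
Lemma dual_vector i : exists (w : I -> int) (N : int),
  N != 0 /\ forall x, bf w x = N * x i.
Proof.
pose A := \matrix_(a < #|I|, b < #|I|)
  ((D (enum_val a))%:Z * C (enum_val a) (enum_val b)).
have reidx (F : I -> int) : \sum_j F j = \sum_(a < #|I|) F (enum_val a).
  by rewrite (reindex _ (onW_bij _ (@enum_val_bij I))).
have bfA (v : 'rV[int]_#|I|) x :
    bf (fun j => v 0 (enum_rank j)) x = \sum_b (v *m A) 0 b * x (enum_val b).
  rewrite /cartan_form exchange_big reidx; apply: eq_bigr => b _.
  rewrite mxE mulr_suml reidx; apply: eq_bigr => a _.
  by rewrite enum_valK mxE.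
have det_neq0 : \det A != 0.
  apply/det0P => -[v v0 vA].
  have : bf (fun j => v 0 (enum_rank j)) (fun j => v 0 (enum_rank j)) = 0.
    by rewrite bfA vA big1 // => b _; rewrite mxE mul0r.
  apply/eqP; rewrite gt_eqF //; apply: (cartan_form_gt0 posC).
  have [/existsP[j vj]|/existsPn H] := boolP [exists j, v 0 (enum_rank j) != 0].
    by exists j.
  case/eqP: v0; apply/rowP => a; move: (H (enum_val a)).
  by rewrite negbK enum_valK mxE => /eqP.
exists (fun j => (row (enum_rank i) (\adj A)) 0 (enum_rank j)), (\det A).
split=> // x; rewrite bfA -row_mul mul_adj_mx (bigD1 (enum_rank i)) //=.
rewrite !mxE eqxx mulr1n enum_rankK big1 ?addr0 // => b /negPf bi.
by rewrite !mxE eq_sym bi mulr0n mul0r.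
Qed.

(** Cauchy-Schwarz against the dual vectors gives N^2 x_i^2 <= (w, w) M, and N^2 >= 1. *)
Lemma cartan_form_bounded (M : int) :
  exists B : nat, forall x, bf x x = M -> forall i, (`|x i| <= B)%N.
Proof.
have /fin_all_exists[f Hf] i :
    exists B : nat, forall x, bf x x = M -> (`|x i| <= B)%N.
  have [w [N [N0 Hw]]] := dual_vector i.
  exists `|(bf w w * M)%R|%N => x xM.
  have := cartan_form_CS symC posC w x; rewrite Hw xM => H.
  have : x i ^+ 2 <= bf w w * M.
    apply: le_trans H; rewrite exprMn ler_peMl ?sqr_ge0 //.
    by rewrite expr2; nia.
  by move: (bf w w * M) => K; nia.
exists (\sum_i f i)%N => x xM i; apply: leq_trans (Hf i x xM) _.
by rewrite (bigD1 i) //= leq_addr.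
Qed.

Lemma simple_reflectionD i : {morph refl i : x y / x + y}.
Proof.
move=> x y; apply/ffunP => j; rewrite [RHS]ffunE !simple_reflectionE [(x + y) j]ffunE.
have -> : coroot_pairing C i (x + y) = coroot_pairing C i x + coroot_pairing C i y.
  by rewrite -big_split; apply: eq_bigr => k _; rewrite ffunE mulrDl.
ring.
Qed.

Lemma simple_reflection0 i : refl i 0 = 0.
Proof.
have := simple_reflectionD i 0 0; rewrite addr0 => /eqP.
by rewrite -subr_eq0 opprD addrA subrr sub0r oppr_eq0 => /eqP.
Qed.

Definition coxeter (s : seq I) (x : Q) : Q := foldl (fun y i => refl i y) x s.

Lemma coxeterD s : {morph coxeter s : x y / x + y}.
Proof.
elim: s => // i s IH x y; rewrite /coxeter /= simple_reflectionD; exact: IH.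
Qed.

Lemma coxeter0 s : coxeter s 0 = 0.
Proof. by elim: s => //= i s; rewrite simple_reflection0. Qed.

Lemma coxeter_rootlike s (x : Q) : rootlike C D x -> rootlike C D (coxeter s x).
Proof.
by elim: s x => //= i s IH x xr; apply: IH; exact: rootlike_reflection.
Qed.

Lemma coxeter_form s (x : Q) : bf (coxeter s x) (coxeter s x) = bf x x.
Proof. by elim: s x => //= i s IH x; rewrite IH cartan_form_reflection. Qed.

Lemma coxeter_off s (x : Q) i : i \notin s -> coxeter s x i = x i.
Proof.
elim: s x => //= j s IH x; rewrite in_cons negb_or => /andP[/negPf ij /IH ->].
by rewrite simple_reflectionE ij mul0r subr0.
Qed.

(** Only the reflection at i changes the coordinate at i, and it occurs once. So in a fixed vector
    each reflection in turn acts trivially. *)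
Lemma coxeter_fixed s (x : Q) : uniq s -> coxeter s x = x ->
  forall i, i \in s -> coroot_pairing C i x = 0.
Proof.
elim: s x => //= i s IH x /andP[ns us] Ex.
have xi : coroot_pairing C i x = 0.
  have := coxeter_off (refl i x) ns; rewrite Ex simple_reflectionE eqxx mul1r; lia.
have fix_x : refl i x = x.
  by apply/ffunP => j; rewrite simple_reflectionE xi mulr0 subr0.
move=> j; rewrite in_cons => /predU1P[-> //|].
by apply: IH us _ j; rewrite -{1}fix_x.
Qed.

Lemma coxeter_fixed0 s (x : Q) : ordering s -> coxeter s x = x -> x = 0.
Proof.
case=> us fs Ex; apply/ffunP => i; rewrite ffunE; apply/eqP.
apply/negPn/negP => xi.
have : bf x x = 0.
  rewrite /cartan_form exchange_big big1 // => j _.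
  have := coxeter_fixed us Ex (fs j); rewrite /coroot_pairing => E.
  have -> : \sum_k x k * ((D k)%:Z * C k j) * x j =
            (D j)%:Z * x j * \sum_k x k * C j k.
    by rewrite mulr_sumr; apply: eq_bigr => k _; rewrite symC.2; ring.
  by rewrite E mulr0.
by move/eqP; rewrite gt_eqF //; apply: (cartan_form_gt0 posC); exists i.
Qed.

(** If the orbit stayed in Q^+, two iterates would coincide, since the coordinates are bounded. The
    sum over the period is fixed by the Coxeter element, hence zero; its terms are nonnegative,
    hence zero too, against (x, x) > 0. *)
Lemma coxeter_leaves s (x : Q) : ordering s -> rootlike C D x ->
  exists m, iter m (coxeter s) x \notin Qplus I.
Proof.
move=> os xr; pose y m := iter m (coxeter s) x.
have yr m : rootlike C D (y m) by elim: m => //= m IH; exact: coxeter_rootlike.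
have yM m : bf (y m) (y m) = bf x x by elim: m => //= m IH; rewrite coxeter_form.
have [B HB] := cartan_form_bounded (bf x x).
(* Absolute values determine the iterates because these are assumed to lie in Q^+; one index more
   than there are codes forces a collision. *)
pose f (m : 'I_(#|{ffun I -> 'I_B.+1}|.+1)) : {ffun I -> 'I_B.+1} :=
  [ffun i => inord `|y m i|].
have [/existsP[m ym]|/existsPn H] :=
    boolP [exists m : 'I_(#|{ffun I -> 'I_B.+1}|.+1), y m \notin Qplus I].
  by exists m.
exfalso; have /injectivePn[m1 [m2 m12 /ffunP f12]] : ~~ injectiveb f.
  apply/injectiveP => /leq_card; rewrite card_ord ltnn //.
have {f12} : y m1 = y m2.
  apply/ffunP => i; have := f12 i; rewrite !ffunE => /(congr1 val).
  rewrite /= !inordK ?ltnS ?HB //.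
  have /forallP/(_ i) := negbNE (H m1); have /forallP/(_ i) := negbNE (H m2).
  lia.
have {m12} : m1 != m2 :> nat by [].
have {H} : forall m, (m < maxn m1.+1 m2.+1)%N -> y m \in Qplus I.
  move=> m ltm; have ltm' : (m < #|{ffun I -> 'I_B.+1}|.+1)%N.
    by apply: leq_trans ltm _; rewrite geq_max !ltn_ord.
  exact: negbNE (H (Ordinal ltm')).
move: (nat_of_ord m1) (nat_of_ord m2) => {m1 m2} m1 m2.
wlog lt12 : m1 m2 / (m1 < m2)%N.
  move=> W H n12 E; have [lt12|lt21|E12] := ltngtP m1 m2.
  - exact: W lt12 H n12 E.
  - by apply: (W _ _ lt21) => //; rewrite 1?maxnC 1?eq_sym.
  - by rewrite E12 eqxx in n12.
move=> posy _ E12.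
pose S := \sum_(l < m2 - m1) y (m1 + l)%N.
have fixS : coxeter s S = S.
  rewrite /S (big_morph (coxeter s) (coxeterD s) (coxeter0 s)).
  move: E12; rewrite -{1}(subnKC (ltnW lt12)).
  case: (m2 - m1)%N => [|k] E12; first by rewrite !big_ord0.
  rewrite big_ord_recr big_ord_recl /= addn0 E12 addrC addnS; congr (_ + _).
  by apply: eq_bigr => l _; rewrite /bump /= addnA addn1 addSn.
have S0 := coxeter_fixed0 os fixS.
have ym0 i : y m1 i = 0.
  have /ffunP/(_ i) := S0; rewrite /S sum_ffunE ffunE.
  have y_ge0 (l : 'I_(m2 - m1)) : 0 <= y (m1 + l)%N i.
    have ltl : (m1 + l < maxn m1.+1 m2.+1)%N by have := ltn_ord l; lia.
    exact: (forallP (posy _ ltl)).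
  have d0 : (0 < m2 - m1)%N by rewrite subn_gt0.
  move=> /eqP; rewrite psumr_eq0 // => /allP/(_ (Ordinal d0)).
  by rewrite mem_index_enum addn0 => /(_ isT)/eqP.
case: (yr m1) => m [m0 + _].
have -> : bf (y m1) (y m1) = 0.
  by rewrite /cartan_form big1 // => i _; rewrite big1 // => j _; rewrite ym0 !mul0r.
lia.
Qed.

(* The ordering s is rotated, as reflecting at its last element n turns n from
   a sink of the associated quiver into a source. *)
Inductive leaves : seq I -> Q -> Prop :=
  | leaves_now s x of x \notin Qplus I : leaves s x
  | leaves_later s n x of leaves (n :: s) (refl n x) : leaves (rcons s n) x.

(** The last element of the ordering is reflected first, hence the reversal of [s2]. *)
Lemma leaves_coxeter s1 s2 x :
  leaves (s2 ++ s1) (coxeter (rev s2) x) -> leaves (s1 ++ s2) x.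
Proof.
elim/last_ind: s2 s1 x => [|s2 n IH] s1 x; first by rewrite cats0.
rewrite rev_rcons cat_rcons -rcons_cat => H; apply: leaves_later.
by rewrite -cat_cons; exact: IH.
Qed.

Lemma rootlike_leaves s (x : Q) : ordering s -> rootlike C D x -> leaves s x.
Proof.
move=> [us fs] xr.
have os : ordering (rev s).
  by split=> [|i]; rewrite ?rev_uniq // mem_rev.
have [m] := coxeter_leaves os xr; elim: m x {xr} => [|m IH] x.
  exact: leaves_now.
rewrite iterSr => /IH H; rewrite -[s]cat0s; apply: leaves_coxeter.
by rewrite cats0.
Qed.

End Coxeter.

(** * Reduction of the number of parts *)

Section Product.

Context (disp : Order.disp_t) (I : finOrderType disp).
Context (C : I -> I -> int) (D : I -> nat).
Hypothesis cartanC : cartan_matrix C.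
Hypothesis symC : symmetrizer C D.
Hypothesis posC : symmetrized_posdef C D.

Local Notation Q := (root_lattice I).
Local Notation refl := (simple_reflection C).
Local Notation eul := (list_euler C D).

Definition root_word (s : seq I) (x : Q) : seq I :=
  flatten [seq nseq `|x i|%N i | i <- s].

Lemma root_word_rcons s n x :
  root_word (rcons s n) x = root_word s x ++ nseq `|x n|%N n.
Proof. by rewrite /root_word map_rcons flatten_rcons. Qed.

Lemma eq_root_word s (x y : Q) : {in s, x =1 y} -> root_word s x = root_word s y.
Proof. by move=> e; congr flatten; apply/eq_in_map => i /e ->. Qed.

Lemma root_word0 s : root_word s 0 = [::].
Proof. by elim: s => //= i s; rewrite /root_word /= ffunE. Qed.

Lemma root_word_notin s n x : n \notin s -> n \notin root_word s x.
Proof.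
move=> ns; apply/flattenP => -[w /mapP[i si ->]]; rewrite mem_nseq => /andP[_ /eqP ni].
by rewrite ni si in ns.
Qed.

Lemma QplusD : {in Qplus I &, forall x y : Q, x + y \in Qplus I}.
Proof.
move=> x y /forallP x0 /forallP y0; apply/forallP => i.
by rewrite ffunE addr_ge0.
Qed.

Lemma Qplus0 : (0 : Q) \in Qplus I.
Proof. by apply/forallP => i; rewrite ffunE. Qed.

Lemma Qplus_sum (A : seq Q) : {subset A <= Qplus I} -> \sum_(u <- A) u \in Qplus I.
Proof.
move=> A0; rewrite big_seq; elim/big_rec: _ => [|u x /A0]; first exact: Qplus0.
exact: QplusD.
Qed.

Lemma root_word_add_simple s n (x : Q) : n \notin s -> x \in Qplus I ->
  root_word (rcons s n) (x + simple_root n) = root_word (rcons s n) x ++ [:: n].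
Proof.
move=> ns /forallP/(_ n) xn; rewrite !root_word_rcons -catA; congr (_ ++ _).
  apply: eq_root_word => i si; rewrite !ffunE.
  by have [ni|_] := eqVneq i n; [rewrite -ni si in ns|rewrite addr0].
rewrite !ffunE eqxx /= -(nseqD _ 1); congr nseq; lia.
Qed.

Lemma ordering_rotate (s : seq I) n : ordering (rcons s n) <-> ordering (n :: s).
Proof.
rewrite /ordering rcons_uniq /=.
by split=> -[? f]; split=> // i; have := f i; rewrite mem_rcons.
Qed.

Lemma ordering_notin (s : seq I) n : ordering (rcons s n) -> n \notin s.
Proof. by case; rewrite rcons_uniq => /andP[]. Qed.

Lemma ordering_mem (s : seq I) n : ordering (rcons s n) -> forall j, j != n -> j \in s.
Proof.
by case=> _ f j jn; have := f j; rewrite mem_rcons in_cons (negPf jn).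
Qed.

Lemma capacity_root_word s n (x : Q) : n \notin s -> x \in Qplus I ->
  (capacity C n (root_word s x))%:Z = - \sum_(j <- s) x j * C n j.
Proof.
move=> ns /forallP x0; rewrite /capacity /root_word big_flatten /= big_map.
rewrite -sumrN (big_morph Posz PoszD (erefl _)) !big_seq; apply: eq_bigr => j js.
have nj : n != j by apply: contraNneq ns => ->.
rewrite big_nseq iter_addn_0 /pivot_coef; have := cartanC.2 _ _ nj.
by have := x0 j; rewrite PoszM; nia.
Qed.

(** With n last, the Euler value of x and alpha_n is d_n (x_n - capacity). So the word ends with
    enough letters n for [push_word], and the surplus stays on the right. *)
Lemma push_root_word s n (x : Q) :
  ordering (rcons s n) -> x \in Qplus I -> 0 <= eul (rcons s n) x (simple_root n) ->
  word_cong C (rcons s n) (n :: root_word (rcons s n) x)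
    (root_word (rcons s n) x ++ [:: n]).
Proof.
move=> os x0 xn; have ns := ordering_notin os; have fs := ordering_mem os.
have cap_le : (capacity C n (root_word s x) <= `|x n|)%N.
  have := capacity_root_word ns x0; move: xn; rewrite (list_euler_rcons symC) ffunE eqxx.
  have -> : eul s x (simple_root n) = 0.
    elim: s ns {os fs} => //= i s IH; rewrite in_cons negb_or => /andP[ni ns].
    rewrite IH // ffunE eq_sym (negPf ni) mulr0 big_seq big1 // => j js.
    rewrite ffunE; have [jn|_] := eqVneq j n; first by rewrite -jn js in ns.
    by rewrite mulr0 mul0r.
  have := forallP x0 n; have := symC.1 n.
  by move: (\sum_(j <- s) _) (capacity _ _ _) => S c; nia.
have r2 j : j != n -> (C j n, C n j) \in rank2_entries.
  exact: (rank2_cartan cartanC symC posC).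
have H := @push_word _ C n s ns fs r2 1 _ (root_word_notin x ns).
rewrite root_word_rcons -catA -[X in nseq X n](subnKC cap_le) nseqD -!catA.
have := word_catr (nseq (`|x n| - capacity C n (root_word s x))%N n) H.
rewrite /= -!catA nseqD -!catA => {}H.
apply: word_trans H _.
by rewrite -(nseqD 1) -(nseqD _ 1) addnC; exact: word_refl.
Qed.

(** The word of s_n x starts with capacity - x_n letters n. All are absorbed since x_n >= 0, and the
    capacity left over yields exactly x_n letters n at the end. *)
Lemma trans_root_word s n (x : Q) : ordering (rcons s n) ->
  x \in Qplus I -> refl n x \in Qplus I ->
  word_cong C (rcons s n) (trans C n 0 (root_word (n :: s) (refl n x)))
    (root_word (rcons s n) x) /\
  overflow C n 0 (root_word (n :: s) (refl n x)) = 0%N.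
Proof.
move=> os x0 rx0; have ns := ordering_notin os; have fs := ordering_mem os.
have os' := (ordering_rotate s n).1 os.
have r2 j : j != n -> (C j n, C n j) \in rank2_entries.
  exact: (rank2_cartan cartanC symC posC).
have nw := root_word_notin x ns.
have -> : root_word (n :: s) (refl n x) =
    nseq `|refl n x n|%N n ++ root_word s x.
  rewrite {1}/root_word /=; congr (_ ++ _); apply: eq_root_word => i si.
  rewrite simple_reflectionE; have [ni|_] := eqVneq i n; first by rewrite -ni si in ns.
  by rewrite mul0r subr0.
have E : refl n x n = (capacity C n (root_word s x))%:Z - x n.
  rewrite simple_reflectionE eqxx mul1r (coroot_pairing_ordering cartanC _ os').
  by rewrite capacity_root_word //; ring.
rewrite trans_pivot overflow_pivot overflow_nonpivot //; split; last first.
  by have := forallP x0 n; have := forallP rx0 n; rewrite E; lia.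
apply: word_trans (trans_nonpivot ns fs r2 _ nw) _.
rewrite root_word_rcons; set k := (_ - _)%N.
have -> : k = `|x n|%N.
  by rewrite /k; have := forallP x0 n; have := forallP rx0 n; rewrite E; lia.
exact: word_refl.
Qed.

Lemma root_word_mul_reflection s n (x y : Q) : ordering (rcons s n) ->
  x \in Qplus I -> y \in Qplus I -> refl n x \in Qplus I -> refl n y \in Qplus I ->
  word_cong C (n :: s) (root_word (n :: s) (refl n x) ++ root_word (n :: s) (refl n y))
    (root_word (n :: s) (refl n x + refl n y)) ->
  word_cong C (rcons s n) (root_word (rcons s n) x ++ root_word (rcons s n) y)
    (root_word (rcons s n) (x + y)).
Proof.
move=> os x0 y0 rx0 ry0 H.
have r2 j : j != n -> (C j n, C n j) \in rank2_entries.
  exact: (rank2_cartan cartanC symC posC).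
have [_] := trans_cong (ordering_notin os) (ordering_mem os) r2 H 0.
have [hx ox] := trans_root_word os x0 rx0.
have [hy oy] := trans_root_word os y0 ry0.
(* The first factor leaves no overflow, so the transducer treats the second factor from counter
   0. *)
rewrite -simple_reflectionD trans_cat ox => T.
apply: word_trans (word_cat (word_sym hx) (word_sym hy)) _.
have rxy : refl n (x + y) \in Qplus I by rewrite simple_reflectionD QplusD.
by have [hxy _] := trans_root_word os (QplusD x0 y0) rxy; exact: word_trans T hxy.
Qed.

Definition positive_rootlike (x : Q) := rootlike C D x /\ x \in Qplus I.

(** [A] and [B] list the parts with multiplicity. The outer induction is on their number, the inner
    one on the rotations after which one chosen part has left Q^+. The inner one never ends in its
    base case, since reflected parts stay positive. *)
Lemma root_word_mul s (A B : seq Q) : ordering s ->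
  (forall u, u \in A ++ B -> positive_rootlike u) ->
  (forall u v, u \in A -> v \in B -> 0 <= eul s v u) ->
  word_cong C s (root_word s (\sum_(u <- A) u) ++ root_word s (\sum_(v <- B) v))
    (root_word s (\sum_(u <- A) u + \sum_(v <- B) v)).
Proof.
have [K] := ubnP (size (A ++ B)); elim: K s A B => // K IHK s A B leK os pos AB.
case EAB: (A ++ B) => [|u0 U].
  case: A B EAB {leK pos AB} => [|//] [|//] _.
  by rewrite !big_nil addr0 root_word0; exact: word_refl.
have : u0 \in A ++ B by rewrite EAB mem_head.
have : leaves C s u0.
  apply: (rootlike_leaves cartanC symC posC os).
  by apply: (pos u0 _).1; rewrite EAB mem_head.
move=> {EAB U} lv.
elim: lv A B leK os pos AB => {s u0} [s x x0|s n x _ IH] A B leK os pos AB.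
  by move=> /pos[_]; rewrite (negPf x0).
move=> xAB; have ns := ordering_notin os.
have [nA|nA] := boolP (simple_root n \in A).
  have pA := perm_to_rem nA; set A' := rem _ A in pA.
  have sub u : u \in A' ++ B -> u \in A ++ B.
    by rewrite !mem_cat (perm_mem pA) in_cons => /orP[->|->]; rewrite ?orbT.
  have A0 : \sum_(u <- A') u \in Qplus I.
    by apply: Qplus_sum => u uA; apply: (pos u _).2; apply: sub; rewrite mem_cat uA.
  have B0 : \sum_(v <- B) v \in Qplus I.
    by apply: Qplus_sum => u uB; apply: (pos u _).2; rewrite mem_cat uB orbT.
  rewrite (perm_big _ pA) /= big_cons; set a := \sum_(u <- A') u in A0 *.
  set b := \sum_(v <- B) v in B0 *.
  rewrite [_ + a]addrC [_ + b]addrAC !root_word_add_simple ?QplusD //.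
  have IH' : word_cong C (rcons s n)
      (root_word (rcons s n) a ++ root_word (rcons s n) b)
      (root_word (rcons s n) (a + b)).
    apply: IHK => //.
    - by move: leK; rewrite !size_cat (perm_size pA).
    - by move=> u /sub /pos.
    - by move=> u v uA; apply: AB; rewrite (perm_mem pA) in_cons uA orbT.
  (* The letter n split off from (d) stands before (e) and is moved across it. *)
  apply: word_trans (word_catr [:: n] IH'); rewrite -!catA; apply: word_catl.
  apply: push_root_word => //.
  by rewrite list_euler_sum big_seq sumr_ge0 // => v vB; exact: AB.
have [nB|nB] := boolP (simple_root n \in B).
  have pB := perm_to_rem nB; set B' := rem _ B in pB.
  have sub u : u \in A ++ B' -> u \in A ++ B.
    by rewrite !mem_cat (perm_mem pB) in_cons => /orP[->|->]; rewrite ?orbT.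
  have A0 : \sum_(u <- A) u \in Qplus I.
    by apply: Qplus_sum => u uA; apply: (pos u _).2; rewrite mem_cat uA.
  have B0 : \sum_(v <- B') v \in Qplus I.
    by apply: Qplus_sum => u uB; apply: (pos u _).2; apply: sub; rewrite mem_cat uB orbT.
  rewrite (perm_big _ pB) /= big_cons [_ + \sum_(_ <- B') _]addrC addrA.
  rewrite !root_word_add_simple ?QplusD // catA; apply: word_catr; apply: IHK => //.
  - by move: leK; rewrite !size_cat (perm_size pB) addnS.
  - by move=> u /sub /pos.
  - by move=> u v uA vB; apply: AB => //; rewrite (perm_mem pB) in_cons vB orbT.
(* No part is alpha_n, so s_n keeps all of them positive and the ordering can be rotated. *)
have neq u : u \in A ++ B -> u != simple_root n.
  by apply: contraTneq => ->; rewrite mem_cat negb_or nA nB.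
have rpos u : u \in A ++ B -> positive_rootlike (refl n u).
  move=> uAB; have [ur u0] := pos _ uAB; split; first exact: rootlike_reflection.
  by apply: (reflection_Qplus cartanC symC posC) => //; exact: neq.
have rsum (X : seq Q) :
    \sum_(u <- [seq refl n v | v <- X]) u = refl n (\sum_(v <- X) v).
  rewrite big_map; symmetry; apply: (big_morph (refl n)).
    exact: simple_reflectionD.
  exact: simple_reflection0.
have posA X : {subset X <= A ++ B} ->
    \sum_(u <- X) u \in Qplus I /\ refl n (\sum_(u <- X) u) \in Qplus I.
  move=> XAB; rewrite -rsum; split; apply: Qplus_sum => u.
    by move=> /XAB /pos[].
  by case/mapP=> v /XAB /rpos[_ ? ->].
have [|A0 rA0] := posA A; first by move=> u uA; rewrite mem_cat uA.
have [|B0 rB0] := posA B; first by move=> u uB; rewrite mem_cat uB orbT.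
apply: root_word_mul_reflection => //; rewrite -!rsum.
have os' := (ordering_rotate s n).1 os.
apply: IH => //; rewrite -?map_cat ?size_map //.
- by move=> u /mapP[v /rpos ? ->].
- move=> _ _ /mapP[u uA ->] /mapP[v vB ->].
  by rewrite (list_euler_reflection cartanC symC) //; exact: AB.
- exact: map_f.
Qed.

End Product.

(** * Comparison with the quantic monoid *)

Section Transfer.

Context (disp : Order.disp_t) (I : finOrderType disp).

Lemma ordering_enum : ordering (Order.enum I).
Proof. by split=> [|i]; rewrite ?sort_uniq ?enum_uniq // mem_sort mem_enum. Qed.

Lemma sorted_enum : sorted <%O (Order.enum I).
Proof. by rewrite lt_sorted_uniq_le sort_uniq enum_uniq sort_le_sorted. Qed.

(** The enumeration of I is sorted, so comparing positions in it is comparing elements. *)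
Lemma word_cong_quantic C u v :
  word_cong C (Order.enum I) u v -> quantic_cong C u v.
Proof.
elim=> {u v} [i j p q r t ij|u|u v _|v u w _ + _|u u' v v' _ + _].
- apply: quantic_rel; have mem k : k \in Order.enum I by exact: ordering_enum.2.
  rewrite -(nth_index i (mem i)) -(nth_index i (mem j)).
  by rewrite (lt_sorted_ltn_nth i sorted_enum) // inE index_mem.
- exact: quantic_refl.
- exact: quantic_sym.
- exact: quantic_trans.
- exact: quantic_cat.
Qed.

Lemma quantic_eltE (C : I -> I -> int) (x : root_lattice I) :
  quantic_elt C x = quantic_class C (root_word (Order.enum I) x).
Proof.
rewrite /quantic_elt /root_word; elim: (Order.enum I) => [|i s IH].
  by rewrite big_nil.
rewrite big_cons IH /=.
have -> k : (quantic_gen C i ^+ k)%g = quantic_class C (nseq k i).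
  elim: k => [|k IHk]; first by rewrite expg0.
  by rewrite expgS IHk [LHS]quantic_mulE.
exact: quantic_mulE.
Qed.

End Transfer.

Theorem proposition2p7 (disp : Order.disp_t) (I : finOrderType disp)
    (C : I -> I -> int) (D : I -> nat) (hC : finite_type_datum C D)
    (d e : root_lattice I) (hd : d \in Qplus I) (he : e \in Qplus I)
    (a b : {fsfun root_lattice I -> nat with 0%N})
    (ha : canonical_decomposition C D d a)
    (hb : canonical_decomposition C D e b)
    (hab : forall u v : root_lattice I, positive_root C u -> positive_root C v ->
       a u != 0%N -> b v != 0%N -> 0 <= euler_form C D v u) :
  (quantic_elt C d * quantic_elt C e)%g = quantic_elt C (d + e).
Proof.
case: hC => cartanC [symC _] posC.
(* The canonical decomposition as a list in which each root is repeated according to its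
   multiplicity. *)
pose parts (f : {fsfun root_lattice I -> nat with 0%N}) :=
  flatten [seq nseq (f u) u | u <- finsupp f].
have mem_parts f u : u \in parts f -> f u != 0%N.
  by case/flattenP=> w /mapP[v _ ->]; rewrite mem_nseq -lt0n => /andP[+ /eqP ->].
have sum_parts x f : canonical_decomposition C D x f -> x = \sum_(u <- parts f) u.
  case=> _ -> _; rewrite /parts big_flatten big_map; apply: eq_bigr => u _.
  by rewrite big_nseq -iter_addr_0.
case: (ha) (hb) => pa _ _ [pb _ _].
rewrite !quantic_eltE [LHS]quantic_mulE; apply/quantic_classP/word_cong_quantic.
rewrite (sum_parts d a ha) (sum_parts e b hb).
apply: (root_word_mul cartanC symC posC).
- exact: ordering_enum.
- move=> u; rewrite mem_cat => /orP[] /mem_parts => [/pa|/pb] [ur u0];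
    split=> //; exact: rootlike_root.
move=> u v /mem_parts au /mem_parts bv.
have := hab u v (pa u au) (pb v bv) au bv; congr (0 <= _).
rewrite (list_euler_sorted C D v u (sorted_enum I)) /euler_form.
rewrite (sum_ordering _ (ordering_enum I)); apply: eq_bigr => i _.
by rewrite (sum_ordering _ (ordering_enum I)).
Qed.
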